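(* Let $V$ be a positively graded (super)space, i.e. an affine (super)space with finitely many coordinates $y^i$, each of definite parity and each assigned a strictly positive integer weight. Let $GG(V)$ be the group of graded polynomial transformations of $V$, and let $\mathrm{Vect}^{-}(V)$ be the space of vector fields on $V$ of negative weight, on which $GG(V)$ acts naturally. Then the representation of $GG(V)$ on $\mathrm{Vect}^{-}(V)$ is faithful.
   Context: Work over $\mathbb{R}$. Coordinates $y^i$ carry a parity in $\mathbb{Z}/2$ and, independently, a weight $w(y^i)\in\mathbb{Z}$, $w(y^i)>0$; they commute up to the sign rule $y^iy^j=(-1)^{\varepsilon_i\varepsilon_j}y^jy^i$, where $\varepsilon_i$ is the parity of $y^i$ (the purely even case is included). Weight is additive under multiplication. Functions on $V$ that are homogeneous in weight are polynomials in the $y^i$, because all weights are positive. $GG(V)$ (''general graded'' group) is the group of all invertible polynomial transformations $y^i\mapsto g^i(y)$ of $V$ preserving both weights and parities, i.e. $g^i(y)$ is homogeneous of the same weight and parity as $y^i$. A vector field $X=X^i(y)\,\partial/\partial y^i$ on $V$ has weight $k$ if each $X^i(y)$ is homogeneous of weight $k+w(y^i)$ (so $\partial/\partial y^i$ has weight $-w(y^i)$). Let $\mathrm{Vect}_k(V)$ denote the space of vector fields of weight $k$. With $N=\max_i w(y^i)$, one has $\mathrm{Vect}^{-}(V)=\mathrm{Vect}_{-N}(V)\oplus\cdots\oplus\mathrm{Vect}_{-1}(V)$. The group $GG(V)$ acts on vector fields by the usual transformation of vector fields under diffeomorphisms (pushforward), and this action preserves weights. *)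

(* Defs.v *)
From HB Require Import structures.
From mathcomp Require Import all_boot all_order all_algebra.
From mathcomp Require Import boolp.
From mathcomp Require Import ssrcomplements mpoly.
From mathcomp Require Import zify ring.

Set Implicit Arguments.
Unset Strict Implicit.
Unset Printing Implicit Defensive.

Import GRing.Theory Num.Theory.
Local Open Scope ring_scope.

(* A graded superspace has two independent gradings on its coordinates:
   parity and weight. *)
Record gspace := GSpace {
  gdim : nat;
  odd_coord : 'I_gdim -> bool;
  weight : 'I_gdim -> nat;
  weight_gt0 : forall i, (0 < weight i)%N }.

Section LinearExtension.
Context (R : comNzRingType) (n : nat) (M : lmodType R).
Implicit Types (phi : 'X_{1..n} -> M) (p q : {mpoly R[n]}).

(* The linear map sending the monomial basis 'X_[m] to phi m. *)
Definition linext phi p : M := \sum_(m <- msupp p) p@_m *: phi m.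

Lemma linextwE phi p k : (msize p <= k)%N ->
  linext phi p = \sum_(m : 'X_{1..n < k}) p@_m *: phi m.
Proof.
move=> lt_pk; rewrite /linext (big_mksub 'X_{1..n < k}) //=; first last.
- by move=> x /msize_mdeg_lt /leq_trans; apply.
- by rewrite msupp_uniq.
by rewrite big_rmcond //= => i; move/memN_msupp_eq0 ->; rewrite scale0r.
Qed.

Lemma linext_is_linear phi : linear (linext phi).
Proof.
move=> c p q.
pose k := maxn (msize (c *: p + q)) (maxn (msize p) (msize q)).
rewrite !(@linextwE _ _ k) ?leq_max ?leqnn ?orbT // scaler_sumr -big_split /=.
by apply: eq_bigr => m _; rewrite mcoeffD mcoeffZ scalerDl scalerA.
Qed.

HB.instance Definition _ phi :=
  GRing.isLinear.Build R {mpoly R[n]} M _ (linext phi) (linext_is_linear phi).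

Lemma linextX phi m : linext phi 'X_[m] = phi m.
Proof. by rewrite /linext msuppX big_seq1 mcoeffX eqxx scale1r. Qed.

Lemma eq_in_linext phi psi p :
  {in msupp p, phi =1 psi} -> linext phi p = linext psi p.
Proof.
by move=> e; rewrite /linext; apply: eq_big_seq => m /e ->.
Qed.

End LinearExtension.

Section SuperPolynomials.
Context (R : realFieldType) (V : gspace).
Local Notation n := (gdim V).
Local Notation eps := (@odd_coord V).
Local Notation w := (@weight V).
Implicit Types (a b m : 'X_{1..n}).

(* The function algebra of V is the free supercommutative algebra on its
   coordinates. Since an odd coordinate squares to zero, a linear basis is given
   by the monomials whose exponents at odd coordinates are at most 1, the monomial
   m standing for the product of the (y^i)^(m i) in increasing order of i. Its
   elements are stored as commutative polynomials supported on these monomials;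
   only the module structure of {mpoly R[n]} is used, the product is smul. *)
Definition reduced m := [forall i, eps i ==> (m i <= 1)%N].

Definition reduced_mpoly : {pred {mpoly R[n]}} :=
  fun p => all reduced (msupp p).

Record spoly := SPoly {
  spoly_val :> {mpoly R[n]};
  _ : reduced_mpoly spoly_val }.

HB.instance Definition _ := [isSub for spoly_val].
HB.instance Definition _ := [Choice of spoly by <:].

Fact spoly_submod_closed :
  submod_closed reduced_mpoly.
Proof.
split; first by rewrite /in_mem /= /reduced_mpoly msupp0.
move=> c p q /allP hp /allP hq; apply/allP => m /msuppD_le.
by rewrite mem_cat => /orP[/msuppZ_le/hp|/hq].
Qed.
HB.instance Definition _ := GRing.isSubmodClosed.Build R {mpoly R[n]} reduced_mpoly
  spoly_submod_closed.
HB.instance Definition _ := [SubChoice_isSubLmodule of spoly by <:].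

(* smon m is zero when m is not reduced. *)
Definition smon m : spoly := insubd (0 : spoly) 'X_[m].
Definition scoord (i : 'I_n) : spoly := smon U_(i).

(* The sign of reordering y^a y^b into y^(a + b): every odd factor y^j of y^b
   moves to the left past the odd factors y^i of y^a with j < i. *)
Definition ksign a b : R :=
  (-1) ^+ (\sum_(i < n) \sum_(j < n | (j < i)%N) (eps i * a i * (eps j * b j))%N).

Definition smul (f g : spoly) : spoly :=
  linext (fun a => linext (fun b => ksign a b *: smon (a + b)%MM) g) f.

Lemma reduced_mpolyX m : reduced_mpoly 'X_[m] = reduced m.
Proof. by rewrite /reduced_mpoly msuppX /= andbT. Qed.

Lemma smon_val m : reduced m -> spoly_val (smon m) = 'X_[m].
Proof. by move=> rm; rewrite /smon [LHS]val_insubd reduced_mpolyX rm. Qed.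

Lemma smonN m : ~~ reduced m -> smon m = 0.
Proof.
by move=> rm; rewrite /smon /insubd insubN // reduced_mpolyX.
Qed.

Lemma spolyE (f : spoly) : f = \sum_(m <- msupp f) f@_m *: smon m.
Proof.
apply: val_inj; rewrite [RHS](raddf_sum (\val : spoly -> {mpoly R[n]})).
rewrite [LHS]mpolyE; apply: eq_big_seq => m mf.
rewrite [RHS](linearZ_LR (\val : spoly -> {mpoly R[n]})) /= smon_val //.
by case: f mf => f /= /allP; apply.
Qed.

Lemma spoly_ind (P : spoly -> Prop) :
  P 0 -> (forall c m f, reduced m -> P f -> P (c *: smon m + f)) -> forall f, P f.
Proof.
move=> P0 PD f; rewrite (spolyE f).
have : all reduced (msupp f) by case: f.
elim: (msupp f) => [|m s IH] /=; first by rewrite big_nil.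
by case/andP=> rm rs; rewrite big_cons; apply: PD => //; apply: IH.
Qed.

Section SLin.
Context (M : lmodType R) (phi : 'X_{1..n} -> M).
Definition slin (f : spoly) : M := linext phi f.
Lemma slin_is_linear : linear slin.
Proof. by move=> c f g; rewrite /slin linearP. Qed.
HB.instance Definition _ :=
  GRing.isLinear.Build R spoly M _ slin slin_is_linear.
Lemma slin_smon m : reduced m -> slin (smon m) = phi m.
Proof. by move=> rm; rewrite /slin smon_val // linextX. Qed.
End SLin.

Lemma reducedDl a b : reduced (a + b)%MM -> reduced a.
Proof.
move=> /forallP h; apply/forallP=> i; apply/implyP=> /(implyP (h i)).
by rewrite mnmDE; lia.
Qed.
Lemma reducedDr a b : reduced (a + b)%MM -> reduced b.
Proof. by rewrite addmC; apply: reducedDl. Qed.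

Lemma reduced0 : reduced 0%MM.
Proof. by apply/forallP=> i; rewrite mnm0E implybT. Qed.

Lemma smul_linearl g : linear (smul^~ g).
Proof. by move=> c f f'; rewrite /smul linearP. Qed.
Lemma smul_linearr f : linear (smul f).
Proof.
move=> c g g'; rewrite /smul /linext scaler_sumr -big_split /=.
apply: eq_bigr => m _; rewrite -/(linext _ _) -/(linext _ _) -/(linext _ _).
by rewrite linearP scalerDr !scalerA [c * _]mulrC.
Qed.

Lemma smul0l f : smul 0 f = 0.
Proof.
by have := smul_linearl f (-1) 0 0; rewrite /= scaler0 addr0 scaleN1r addNr.
Qed.
Lemma smul0r f : smul f 0 = 0.
Proof.
by have := smul_linearr f (-1) 0 0; rewrite /= scaler0 addr0 scaleN1r addNr.
Qed.
Lemma smulZl c f g : smul (c *: f) g = c *: smul f g.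
Proof. by have := smul_linearl g c f 0; rewrite /= smul0l !addr0. Qed.
Lemma smulZr c f g : smul f (c *: g) = c *: smul f g.
Proof. by have := smul_linearr f c g 0; rewrite /= smul0r !addr0. Qed.
Lemma smulDl : left_distributive smul +%R.
Proof. by move=> f g h; have := smul_linearl h 1 f g; rewrite /= !scale1r. Qed.
Lemma smulDr : right_distributive smul +%R.
Proof. by move=> f g h; have := smul_linearr f 1 g h; rewrite /= !scale1r. Qed.

Lemma smul_smon a b : smul (smon a) (smon b) = ksign a b *: smon (a + b)%MM.
Proof.
have [ra|ra] := boolP (reduced a); last first.
  rewrite (smonN ra) smul0l smonN ?scaler0 //.
  by apply: contra ra => /reducedDl.
have [rb|rb] := boolP (reduced b); last first.
  rewrite (smonN rb) smul0r smonN ?scaler0 //.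
  by apply: contra rb => /reducedDr.
by rewrite /smul (smon_val ra) linextX (smon_val rb) linextX.
Qed.

Let ks a b : nat := \sum_(i < n) \sum_(j < n | (j < i)%N) (eps i * a i * (eps j * b j))%N.
Let ksE a b : ksign a b = (-1) ^+ ks a b. Proof. by []. Qed.

Lemma ks_addl a b c : ks (a + b)%MM c = (ks a c + ks b c)%N.
Proof.
rewrite /ks -big_split /=; apply: eq_bigr => i _; rewrite -big_split /=.
by apply: eq_bigr => j _; rewrite mnmDE; ring.
Qed.
Lemma ks_addr a b c : ks a (b + c)%MM = (ks a b + ks a c)%N.
Proof.
rewrite /ks -big_split /=; apply: eq_bigr => i _; rewrite -big_split /=.
by apply: eq_bigr => j _; rewrite mnmDE; ring.
Qed.
Lemma ks_0l b : ks 0%MM b = 0%N.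
Proof. by rewrite /ks big1 // => i _; rewrite big1 // => j _; rewrite mnm0E muln0. Qed.
Lemma ks_0r b : ks b 0%MM = 0%N.
Proof. by rewrite /ks big1 // => i _; rewrite big1 // => j _; rewrite mnm0E !muln0. Qed.

Lemma smulA : associative smul.
Proof.
elim/spoly_ind => [|c1 a f _ IHf] g h; first by rewrite !smul0l.
rewrite !smulDl !smulZl IHf; congr (_ *: _ + _) => {f IHf c1}.
elim/spoly_ind: g => [|c2 b g _ IHg]; first by rewrite !(smul0l, smul0r).
rewrite smulDr !smulDl smulDr !(smulZr, smulZl) IHg; congr (_ *: _ + _) => {g IHg c2}.
elim/spoly_ind: h => [|c3 c h _ IHh]; first by rewrite !smul0r.
rewrite !smulDr !smulZr IHh; congr (_ *: _ + _) => {h IHh c3}.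
rewrite !smul_smon smulZl smulZr !smul_smon !scalerA addmA !ksE -!exprD.
by rewrite ks_addl ks_addr; congr (_ ^+ _ *: _); lia.
Qed.

Lemma smul1l : left_id (smon 0%MM) smul.
Proof.
elim/spoly_ind => [|c a f _ IHf]; first by rewrite !smul0r.
by rewrite smulDr smulZr IHf smul_smon add0m ksE ks_0l scale1r.
Qed.
Lemma smul1r : right_id (smon 0%MM) smul.
Proof.
elim/spoly_ind => [|c a f _ IHf]; first by rewrite !smul0l.
by rewrite smulDl smulZl IHf smul_smon addm0 ksE ks_0r scale1r.
Qed.

Lemma smon0_neq0 : smon 0%MM != 0.
Proof.
apply/eqP => /(congr1 spoly_val); rewrite smon_val ?reduced0 //= => /eqP.
by rewrite -msupp_eq0 msuppX.
Qed.

HB.instance Definition _ := GRing.Zmodule_isNzRing.Build spoly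
  smulA smul1l smul1r smulDl smulDr smon0_neq0.
HB.instance Definition _ := GRing.Lmodule_isLalgebra.Build R spoly
  (fun c f g => esym (smulZl c f g)).
HB.instance Definition _ := GRing.Lalgebra_isAlgebra.Build R spoly
  (fun c f g => esym (smulZr c f g)).


Lemma smonM a b : smon a * smon b = ksign a b *: smon (a + b)%MM.
Proof. exact: smul_smon. Qed.
Lemma smon0 : smon 0%MM = 1. Proof. by []. Qed.

Definition monpar m : nat := (\sum_(i < n) eps i * m i)%N.
Definition monwt m : nat := (\sum_(i < n) m i * w i)%N.
Definition has_parity (e : bool) (f : spoly) :=
  all (fun m => odd (monpar m) == e) (msupp f).
Definition has_weight (d : int) (f : spoly) :=
  all (fun m => (monwt m)%:Z == d) (msupp f).

Lemma monparD a b : monpar (a + b)%MM = (monpar a + monpar b)%N.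
Proof.
by rewrite /monpar -big_split; apply: eq_bigr => i _; rewrite mnmDE mulnDr.
Qed.
Lemma monwtD a b : monwt (a + b)%MM = (monwt a + monwt b)%N.
Proof.
by rewrite /monwt -big_split; apply: eq_bigr => i _; rewrite mnmDE mulnDl.
Qed.
Lemma monparU i : monpar U_(i)%MM = eps i.
Proof.
rewrite /monpar (bigD1 i) //= mnm1E eqxx muln1 big1 ?addn0 // => j ji.
by rewrite mnm1E eq_sym (negPf ji) muln0.
Qed.
Lemma monwtU i : monwt U_(i)%MM = w i.
Proof.
rewrite /monwt (bigD1 i) //= mnm1E eqxx mul1n big1 ?addn0 // => j ji.
by rewrite mnm1E eq_sym (negPf ji).
Qed.
Lemma monpar0 : monpar 0%MM = 0%N.
Proof. by rewrite /monpar big1 // => i _; rewrite mnm0E muln0. Qed.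
Lemma monwt0 : monwt 0%MM = 0%N.
Proof. by rewrite /monwt big1 // => i _; rewrite mnm0E. Qed.

Section SupportIn.
Variable P : pred 'X_{1..n}.
Definition supp_in (f : spoly) := all P (msupp f).

Lemma supp_in0 : supp_in 0.
Proof. by rewrite /supp_in msupp0. Qed.
Lemma supp_inP c f g : supp_in f -> supp_in g -> supp_in (c *: f + g).
Proof.
move=> /allP hf /allP hg; apply/allP => m /msuppD_le.
by rewrite mem_cat => /orP[/msuppZ_le/hf|/hg].
Qed.
Lemma supp_inZ c f : supp_in f -> supp_in (c *: f).
Proof. by move=> hf; rewrite -[_ *: _]addr0; apply: supp_inP => //; apply: supp_in0. Qed.
Lemma supp_inD f g : supp_in f -> supp_in g -> supp_in (f + g).
Proof. by move=> hf hg; rewrite -[f]scale1r; apply: supp_inP. Qed.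
Lemma supp_in_sum I (r : seq I) (Q : pred I) F :
  (forall i, Q i -> supp_in (F i)) -> supp_in (\sum_(i <- r | Q i) F i).
Proof. by move=> h; elim/big_ind: _ => //; [apply: supp_in0|apply: supp_inD]. Qed.
Lemma supp_in_smon m : P m -> supp_in (smon m).
Proof.
move=> Pm; have [rm|rm] := boolP (reduced m).
  by rewrite /supp_in smon_val // msuppX /= Pm.
by rewrite smonN // supp_in0.
Qed.
Lemma supp_in_smonE m : reduced m -> supp_in (smon m) = P m.
Proof. by move=> rm; rewrite /supp_in smon_val // msuppX /= andbT. Qed.
Lemma supp_in_ind (Q : spoly -> Prop) :
  Q 0 -> (forall c m f, reduced m -> P m -> Q f -> Q (c *: smon m + f)) ->
  forall f, supp_in f -> Q f.
Proof.
move=> Q0 QD f hf; have rf : all reduced (msupp f) by case: f {hf}.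
suff : Q (\sum_(m <- msupp f) f@_m *: smon m) by rewrite -spolyE.
move: hf rf; rewrite /supp_in.
elim: (msupp f) => [|m s IH] /=; first by rewrite big_nil.
by case/andP=> Pm Ps /andP[rm rs]; rewrite big_cons; apply: QD => //; apply: IH.
Qed.
End SupportIn.

Lemma supp_in_bilin (P Q S : pred 'X_{1..n}) f g :
  (forall a b, P a -> Q b -> S (a + b)%MM) ->
  supp_in P f -> supp_in Q g -> supp_in S (f * g).
Proof.
move=> PQS hf hg; elim/supp_in_ind: f / hf => [|c a f _ Pa IH].
  by rewrite mul0r supp_in0.
rewrite mulrDl -scalerAl; apply: supp_inP => // {IH f}.
elim/supp_in_ind: g / hg => [|d b g _ Qb IH]; first by rewrite mulr0 supp_in0.
rewrite mulrDr -scalerAr; apply: supp_inP => //.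
by rewrite smonM; apply/supp_inZ/supp_in_smon/PQS.
Qed.

Lemma has_parityM e e' f g :
  has_parity e f -> has_parity e' g -> has_parity (e (+) e') (f * g).
Proof.
apply: supp_in_bilin => a b /eqP <- /eqP <-.
by rewrite monparD oddD.
Qed.
Lemma has_weightM d d' f g :
  has_weight d f -> has_weight d' g -> has_weight (d + d') (f * g).
Proof.
apply: supp_in_bilin => a b /eqP <- /eqP <-.
by rewrite monwtD PoszD.
Qed.
Lemma has_parity1 : has_parity false 1.
Proof. by rewrite -smon0; apply: supp_in_smon; rewrite monpar0. Qed.
Lemma has_weight1 : has_weight 0 1.
Proof. by rewrite -smon0; apply: supp_in_smon; rewrite monwt0. Qed.
Lemma has_parity_scoord i : has_parity (eps i) (scoord i).
Proof. by apply: supp_in_smon; rewrite monparU; case: (eps i). Qed.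
Lemma has_weight_scoord i : has_weight (w i) (scoord i).
Proof. by apply: supp_in_smon; rewrite monwtU. Qed.

Lemma ks_sym a b : reduced (a + b)%MM ->
  (ks a b + ks b a = monpar a * monpar b)%N.
Proof.
move=> /forallP rab; rewrite /monpar big_distrl /= /ks.
have -> : (\sum_(i < n) \sum_(j < n | (j < i)%N) eps i * b i * (eps j * a j) =
  \sum_(i < n) \sum_(j < n | (i < j)%N) eps i * a i * (eps j * b j))%N.
  rewrite [RHS](exchange_big_dep predT) //=.
  by apply: eq_bigr => i _; apply: eq_bigr => j _; rewrite mulnC.
rewrite -big_split /=; apply: eq_bigr => i _; rewrite big_distrr /=.
rewrite [RHS](bigID (fun j : 'I_n => (j < i)%N)) /=; congr (_ + _)%N => //.
rewrite [RHS](bigD1 i) ?ltnn //=.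
have -> : (eps i * a i * (eps i * b i) = 0)%N.
  have := rab i; rewrite mnmDE; case: (eps i) => //=.
  by case: (a i) => [|[|?]]; case: (b i) => [|?] //=; rewrite ?muln0.
by rewrite add0n; apply: eq_bigl => j; rewrite -leqNgt ltn_neqAle andbC eq_sym.
Qed.

Lemma smonC a b :
  smon a * smon b = (-1) ^+ (monpar a * monpar b)%N *: (smon b * smon a).
Proof.
rewrite !smonM [in RHS]addmC scalerA.
have [r|/smonN->] := boolP (reduced (a + b)%MM); last by rewrite !scaler0.
rewrite -(ks_sym r) !ksE -exprD -addnA addnn exprD -mul2n exprM sqrrN expr1n.
by rewrite expr1n mulr1.
Qed.

Lemma supercomm e e' f g : has_parity e f -> has_parity e' g ->
  f * g = (-1) ^+ (e && e') *: (g * f).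
Proof.
move=> hf hg; elim/supp_in_ind: f / hf => [|c a f _ /eqP Pa IH].
  by rewrite mul0r mulr0 scaler0.
rewrite mulrDl mulrDr scalerDr IH -scalerAl -scalerAr; congr (_ + _) => {IH f}.
rewrite scalerA mulrC -scalerA; congr (_ *: _).
elim/supp_in_ind: g / hg => [|d b g _ /eqP Qb IH].
  by rewrite mul0r mulr0 scaler0.
rewrite mulrDr mulrDl scalerDr IH -scalerAl -scalerAr; congr (_ + _) => {IH g}.
rewrite scalerA mulrC -scalerA; congr (_ *: _).
by rewrite smonC -signr_odd oddM Pa Qb.
Qed.

Lemma odd_sqr f : has_parity true f -> f * f = 0.
Proof.
move=> hf; have := supercomm hf hf; rewrite /= expr1 scaleN1r => /eqP.
rewrite -addr_eq0 -mulr2n -scaler_nat scaler_eq0 pnatr_eq0 /=.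
by move/eqP.
Qed.

(* Left derivatives: the odd derivation d/dy^j moves past the factors y^i, i < j. *)
Definition deriv_sign (j : 'I_n) m : R :=
  (-1) ^+ (\sum_(i < n | (i < j)%N) eps i * m i * eps j).

Definition sderiv (j : 'I_n) (f : spoly) : spoly :=
  slin (fun m => (deriv_sign j m *+ m j) *: smon (m - U_(j))%MM) f.

Definition smap := {ffun 'I_n -> spoly}.

(* pullback g f is f(g(y)); the product is taken in increasing order of i, as in
   the monomials themselves. It is an algebra morphism when g preserves parity. *)
Definition pullback (g : smap) (f : spoly) : spoly :=
  slin (fun m => \prod_(i < n) g i ^+ m i) f.

(* scomp g h is the transformation y |-> g(h(y)). *)
Definition scomp (g h : smap) : smap := [ffun i => pullback h (g i)].
Definition sid : smap := [ffun i => scoord i].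
Definition smap_even (g : smap) := [forall i, has_parity (eps i) (g i)].
Definition smap_weight (g : smap) := [forall i, has_weight (w i) (g i)].

Lemma pullback_is_linear g : linear (pullback g).
Proof. exact: slin_is_linear. Qed.
HB.instance Definition _ g :=
  GRing.isLinear.Build R spoly spoly _ (pullback g) (pullback_is_linear g).
Lemma sderiv_is_linear j : linear (sderiv j).
Proof. exact: slin_is_linear. Qed.
HB.instance Definition _ j :=
  GRing.isLinear.Build R spoly spoly _ (sderiv j) (sderiv_is_linear j).

Lemma pullbackP g c f f' :
  pullback g (c *: f + f') = c *: pullback g f + pullback g f'.
Proof. exact: slin_is_linear. Qed.
Lemma sderivP j c f f' :
  sderiv j (c *: f + f') = c *: sderiv j f + sderiv j f'.
Proof. exact: slin_is_linear. Qed.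
Lemma pullback0 g : pullback g 0 = 0.
Proof. exact: linear0. Qed.
Lemma sderiv0 j : sderiv j 0 = 0.
Proof. exact: linear0. Qed.
Lemma pullbackZ g c f : pullback g (c *: f) = c *: pullback g f.
Proof. by rewrite -[_ *: f]addr0 pullbackP pullback0 addr0. Qed.
Lemma sderivZ j c f : sderiv j (c *: f) = c *: sderiv j f.
Proof. by rewrite -[_ *: f]addr0 sderivP sderiv0 addr0. Qed.
Lemma pullback_sum g I (r : seq I) F :
  pullback g (\sum_(i <- r) F i) = \sum_(i <- r) pullback g (F i).
Proof. exact: (raddf_sum (pullback g)). Qed.

Lemma pullback_smon g m : reduced m ->
  pullback g (smon m) = \prod_(i < n) g i ^+ m i.
Proof. by move=> rm; rewrite /pullback slin_smon. Qed.

Lemma ks_Ul i m : ks U_(i) m = (\sum_(j < n | (j < i)%N) eps i * (eps j * m j))%N.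
Proof.
rewrite /ks (bigD1 i) //= [X in (_ + X)%N]big1 ?addn0; last first.
  by move=> k ki; rewrite big1 // => j _; rewrite mnm1E eq_sym (negPf ki) muln0.
by apply: eq_bigr => j _; rewrite mnm1E eqxx muln1.
Qed.

Lemma has_parityX e f k : has_parity e f -> has_parity (odd (e * k)) (f ^+ k).
Proof.
move=> hf; elim: k => [|k IH]; first by rewrite muln0 expr0 has_parity1.
by rewrite exprS mulnS oddD oddb; apply: has_parityM.
Qed.
Lemma has_weightX d f k : has_weight d f -> has_weight (d *+ k) (f ^+ k).
Proof.
move=> hf; elim: k => [|k IH]; first by rewrite mulr0n expr0 has_weight1.
by rewrite exprS mulrS; apply: has_weightM.
Qed.

Lemma coord_prod (g : smap) (r : seq 'I_n) i m : smap_even g ->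
  pairwise (fun j k : 'I_n => (j < k)%N) r -> i \in r ->
  g i * \prod_(j <- r) g j ^+ m j =
  (-1) ^+ (\sum_(j <- r | (j < i)%N) eps i * (eps j * m j))%N *:
    \prod_(j <- r) g j ^+ (U_(i) + m)%MM j.
Proof.
move=> /forallP ge; elim: r => //= k r IH /andP[/allP kr pr].
rewrite inE !big_cons; have [-> _|ik /= ir] := eqVneq i k.
  have -> : (\sum_(j <- r | (j < k)%N) eps k * (eps j * m j) = 0)%N.
    rewrite big_seq_cond big1 // => j /andP[/kr/= kj jk].
    by have := ltn_trans kj jk; rewrite ltnn.
  rewrite ltnn scale1r.
  rewrite mulrA -exprS mnmDE mnm1E eqxx add1n; congr (_ * _).
  apply: eq_big_seq => j /kr; rewrite mnmDE mnm1E.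
  by case: eqVneq => [->|//]; rewrite ltnn.
rewrite (kr _ ir) mulrA (supercomm (ge i) (has_parityX (m k) (ge k))).
have -> : (-1) ^+ (eps i && odd (eps k * m k)) =
    (-1) ^+ (eps i * (eps k * m k))%N :> R.
  by rewrite -[in RHS]signr_odd (oddM (eps i)) oddb.
rewrite -scalerAl -mulrA IH // -scalerAr scalerA -exprD.
by rewrite mnmDE mnm1E (negPf ik) add0n.
Qed.

Lemma pairwise_enum_ord :
  pairwise (fun j k : 'I_n => (j < k)%N) (index_enum 'I_n).
Proof.
rewrite -(pairwise_map (fun i : 'I_n => i : nat) ltn).
have -> : map (fun i : 'I_n => i : nat) (index_enum 'I_n) = iota 0 n.
  by rewrite -val_enum_ord enumT /index_enum -enumT.
by rewrite -sorted_pairwise ?iota_ltn_sorted //; apply: ltn_trans.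
Qed.

Lemma coord_mon (g : smap) i m : smap_even g ->
  g i * \prod_(j < n) g j ^+ m j =
  (-1) ^+ (ks U_(i) m) *: \prod_(j < n) g j ^+ (U_(i) + m)%MM j.
Proof.
move=> ge; rewrite (coord_prod _ ge pairwise_enum_ord) ?mem_index_enum //.
by rewrite ks_Ul.
Qed.

Lemma prod_nonreduced (g : smap) m : smap_even g -> ~~ reduced m ->
  \prod_(j < n) g j ^+ m j = 0.
Proof.
move=> /forallP ge; rewrite negb_forall => /existsP[i].
rewrite negb_imply -ltnNge => /andP[ei mi].
have gi0 : g i ^+ m i = 0.
  rewrite -(subnKC mi) exprD expr2 odd_sqr ?mul0r //.
  by have := ge i; rewrite ei.
suff h (r : seq 'I_n) : i \in r -> \prod_(j <- r) g j ^+ m j = 0.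
  by apply: h; rewrite mem_index_enum.
elim: r => // k r IH; rewrite inE big_cons => /orP[/eqP<-|/IH->].
  by rewrite gi0 mul0r.
by rewrite mulr0.
Qed.

Lemma pullback_smonT g m : smap_even g ->
  pullback g (smon m) = \prod_(i < n) g i ^+ m i.
Proof.
move=> ge; have [/pullback_smon->//|rm] := boolP (reduced m).
by rewrite smonN // pullback0 prod_nonreduced.
Qed.

Lemma scoordM i m : scoord i * smon m = (-1) ^+ (ks U_(i) m) *: smon (U_(i) + m)%MM.
Proof. exact: smonM. Qed.

Lemma pullback_coordM g i f : smap_even g ->
  pullback g (scoord i * f) = g i * pullback g f.
Proof.
move=> ge; elim/spoly_ind: f => [|c m f _ IH].
  by rewrite mulr0 !pullback0 mulr0.
rewrite mulrDr -scalerAr !pullbackP IH mulrDr -scalerAr; congr (_ *: _ + _).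
by rewrite scoordM pullbackZ !pullback_smonT // coord_mon.
Qed.

Lemma pullback1 g : pullback g 1 = 1.
Proof.
rewrite -{1}smon0 pullback_smon ?reduced0 // big1 // => i _.
by rewrite mnm0E expr0.
Qed.

Lemma smon_coord_ind (Q : 'X_{1..n} -> Prop) : Q 0%MM ->
  (forall i m, Q m -> Q (U_(i) + m)%MM) -> forall m, Q m.
Proof.
move=> Q0 QS m; elim: {m}(mdeg m) {-2}m (erefl (mdeg m)) => [|k IH] m.
  by move/eqP; rewrite mdeg_eq0 => /eqP->.
move=> hk; have : mdeg m != 0%N by rewrite hk.
rewrite mdegE sum_nat_eq0 negb_forall => /existsP[i /= mi].
have E : m = (U_(i) + (m - U_(i)))%MM.
  apply/mnmP => j; rewrite mnmDE mnmBE mnm1E; case: eqVneq => [<-|_] /=.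
    by lia.
  by rewrite subn0.
rewrite E; apply/QS/IH.
by have := congr1 (@mdeg _) E; rewrite mdegD mdeg1 hk; lia.
Qed.

Lemma spoly_coord_ind (Q : spoly -> Prop) :
  Q 0 -> Q 1 -> (forall c f g, Q f -> Q g -> Q (c *: f + g)) ->
  (forall i f, Q f -> Q (scoord i * f)) -> forall f, Q f.
Proof.
move=> Q0 Q1 QD QM; elim/spoly_ind => // c m f _; apply: (QD).
elim/smon_coord_ind: m {c f} => [|i m Qm]; first by rewrite smon0.
have E : smon (U_(i) + m)%MM = (-1) ^+ ks U_(i) m *: (scoord i * smon m) + 0.
  by rewrite addr0 scoordM scalerA -exprD addnn -mul2n exprM sqrrN !expr1n scale1r.
by rewrite E; apply: QD => //; apply: QM.
Qed.

Lemma pullbackM g : smap_even g -> {morph pullback g : f f' / f * f'}.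
Proof.
move=> ge f f'; elim/spoly_coord_ind: f => [||c f1 f2 IH1 IH2|i f IH].
- by rewrite mul0r !pullback0 mul0r.
- by rewrite pullback1 !mul1r.
- by rewrite mulrDl -scalerAl !pullbackP IH1 IH2 mulrDl -scalerAl.
- by rewrite -mulrA !pullback_coordM // IH mulrA.
Qed.

Lemma pullback_coord g i : smap_even g -> pullback g (scoord i) = g i.
Proof.
by move=> ge; rewrite -[scoord i]mulr1 pullback_coordM // pullback1 mulr1.
Qed.

Lemma sid_even : smap_even sid.
Proof. by apply/forallP => i; rewrite ffunE has_parity_scoord. Qed.
Lemma sid_weight : smap_weight sid.
Proof. by apply/forallP => i; rewrite ffunE has_weight_scoord. Qed.

Lemma has_parity_prod (g : smap) m (r : seq 'I_n) : smap_even g ->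
  has_parity (odd (\sum_(i <- r) eps i * m i)) (\prod_(i <- r) g i ^+ m i).
Proof.
move=> /forallP ge; elim: r => [|i r IH]; first by rewrite !big_nil has_parity1.
by rewrite !big_cons oddD; apply/has_parityM/IH/has_parityX.
Qed.
Lemma has_weight_prod (g : smap) m (r : seq 'I_n) : smap_weight g ->
  has_weight (\sum_(i <- r) m i * w i)%N (\prod_(i <- r) g i ^+ m i).
Proof.
move=> /forallP ge; elim: r => [|i r IH]; first by rewrite !big_nil has_weight1.
rewrite !big_cons PoszD; apply/has_weightM/IH.
have := has_weightX (m i) (ge i); rewrite -mulr_natr natz -PoszM mulnC; apply.
Qed.

Lemma supp_in_slin (P S : pred 'X_{1..n}) (phi : 'X_{1..n} -> spoly) f :
  (forall m, reduced m -> P m -> supp_in S (phi m)) ->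
  supp_in P f -> supp_in S (slin phi f).
Proof.
move=> h hf; elim/supp_in_ind: f / hf => [|c m f rm Pm IH].
  by rewrite (linear0 (slin phi)) supp_in0.
rewrite [slin _ _]slin_is_linear slin_smon //; apply: supp_inP => //; exact: h.
Qed.

Lemma pullback_parity g e f :
  smap_even g -> has_parity e f -> has_parity e (pullback g f).
Proof.
move=> ge; apply: supp_in_slin => m rm /eqP <-.
exact: has_parity_prod.
Qed.

Lemma pullback_weight g d f :
  smap_weight g -> has_weight d f -> has_weight d (pullback g f).
Proof.
move=> ge; apply: supp_in_slin => m rm /eqP <-.
exact: has_weight_prod.
Qed.

Lemma scomp_even g h : smap_even g -> smap_even h -> smap_even (scomp g h).
Proof.
move=> /forallP ge he; apply/forallP => i; rewrite ffunE.
exact: pullback_parity.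
Qed.
Lemma scomp_weight g h : smap_weight g -> smap_weight h -> smap_weight (scomp g h).
Proof.
move=> /forallP ge he; apply/forallP => i; rewrite ffunE.
exact: pullback_weight.
Qed.

Lemma pullback_comp g h f : smap_even g -> smap_even h ->
  pullback (scomp g h) f = pullback h (pullback g f).
Proof.
move=> ge he; have gh := scomp_even ge he.
elim/spoly_coord_ind: f => [||c f1 f2 IH1 IH2|i f IH].
- by rewrite !pullback0.
- by rewrite !pullback1.
- by rewrite !pullbackP IH1 IH2.
- by rewrite !pullback_coordM // pullbackM // IH ffunE.
Qed.

Lemma pullback_sid f : pullback sid f = f.
Proof.
elim/spoly_coord_ind: f => [||c f1 f2 IH1 IH2|i f IH].
- by rewrite pullback0.
- by rewrite pullback1.
- by rewrite pullbackP IH1 IH2.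
- by rewrite pullback_coordM ?sid_even // IH ffunE.
Qed.

Lemma smonE m : reduced m -> smon m = \prod_(i < n) scoord i ^+ m i.
Proof.
move=> rm; rewrite -[LHS]pullback_sid pullback_smon //.
by apply: eq_bigr => i _; rewrite ffunE.
Qed.
Lemma scoordC i j :
  scoord i * scoord j = (-1) ^+ (eps i && eps j) *: (scoord j * scoord i).
Proof. by apply: supercomm; apply: has_parity_scoord. Qed.

Lemma scompA g h k : smap_even h -> smap_even k ->
  scomp g (scomp h k) = scomp (scomp g h) k.
Proof. by move=> he ke; apply/ffunP => i; rewrite !ffunE pullback_comp. Qed.
Lemma scomp1l g : smap_even g -> scomp sid g = g.
Proof. by move=> ge; apply/ffunP => i; rewrite !ffunE pullback_coord. Qed.
Lemma scomp1r g : scomp g sid = g.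
Proof. by apply/ffunP => i; rewrite !ffunE pullback_sid. Qed.

(* The homogeneous component of weight d. *)
Definition wcomp (d : int) (f : spoly) : spoly :=
  slin (fun m => if (monwt m)%:Z == d then smon m else 0) f.

Lemma wcomp_weight d f : has_weight d (wcomp d f).
Proof.
apply: (@supp_in_slin predT); last exact/allP.
by move=> m _ _; case: ifP => [/eqP<-|_]; [apply: supp_in_smon|apply: supp_in0].
Qed.
Lemma wcomp_id d d' f : has_weight d' f ->
  wcomp d f = if d' == d then f else 0.
Proof.
move=> hf; elim/supp_in_ind: f / hf => [|c m f rm /eqP mP IH].
  by rewrite [wcomp _ _]linear0 if_same.
rewrite [wcomp _ _]slin_is_linear slin_smon // -/(wcomp d f) IH mP.
by case: ifP => _ //; rewrite scaler0 addr0.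
Qed.
Lemma pullback_wcomp g d f : smap_weight g -> 
  pullback g (wcomp d f) = wcomp d (pullback g f).
Proof.
move=> gw; elim/spoly_ind: f => [|c m f rm IH].
  by rewrite [wcomp _ 0]linear0 pullback0 [RHS]linear0.
rewrite [wcomp _ (_ + _)]slin_is_linear -/(wcomp d f) -/(wcomp d (smon m)).
rewrite !pullbackP IH [RHS]slin_is_linear; congr (_ *: _ + _).
have hm : has_weight (monwt m) (smon m) by apply: supp_in_smon.
rewrite (wcomp_id _ hm) -/(wcomp _ _) (wcomp_id _ (pullback_weight gw hm)).
by case: ifP => //; rewrite pullback0.
Qed.

Lemma inverse_weight g h : smap_even g -> smap_even h -> smap_weight g ->
  scomp g h = sid -> scomp h g = sid -> smap_weight h.
Proof.
move=> ge he gw gh hg; apply/forallP => i.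
suff <- : wcomp (w i) (h i) = h i by apply: wcomp_weight.
apply: (can_inj (g := pullback h) (f := pullback g)).
  by move=> f; rewrite -pullback_comp // gh pullback_sid.
rewrite pullback_wcomp //.
have -> : pullback g (h i) = scoord i.
  by have /ffunP/(_ i) := hg; rewrite !ffunE.
by rewrite (wcomp_id _ (has_weight_scoord i)) eqxx.
Qed.

Lemma deriv_signE j m : deriv_sign j m = (-1) ^+ ks U_(j) m.
Proof.
by rewrite /deriv_sign ks_Ul; congr (_ ^+ _); apply: eq_bigr => i _; rewrite mulnC.
Qed.
Lemma sderiv_smon j m : reduced m ->
  sderiv j (smon m) = ((-1) ^+ ks U_(j) m *+ m j) *: smon (m - U_(j))%MM.
Proof. by move=> rm; rewrite /sderiv slin_smon // deriv_signE. Qed.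
Lemma ks_UU i j : ks U_(i) U_(j) = ((j < i) && (eps i && eps j))%N.
Proof.
rewrite ks_Ul; case: ltnP => ji /=.
  rewrite (bigD1 j) //= mnm1E eqxx muln1 mulnb big1 ?addn0 // => k /andP[_ kj].
  by rewrite mnm1E eq_sym (negPf kj) !muln0.
rewrite big1 // => k ki; rewrite mnm1E; case: eqVneq ki => [<-|]; last by rewrite !muln0.
by rewrite ltnNge ji.
Qed.
Lemma ks_even i m : eps i = false -> ks U_(i) m = 0%N.
Proof. by move=> ei; rewrite ks_Ul big1 // => j _; rewrite ei. Qed.

Lemma signr_dbl k : (-1) ^+ (k + k)%N = 1 :> R.
Proof. by rewrite addnn -mul2n exprM sqrrN !expr1n. Qed.

Lemma mnm_pred j m : (0 < m j)%N -> m = (U_(j) + (m - U_(j)))%MM.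
Proof.
move=> mj; apply/mnmP => i; rewrite mnmDE mnmBE mnm1E.
by case: eqVneq => [<-|_] /=; [lia|rewrite subn0].
Qed.
Lemma addmKl j m : (U_(j) + m - U_(j))%MM = m.
Proof. by apply/mnmP => i; rewrite mnmBE mnmDE addKn. Qed.

Lemma sderiv_coordM_smon i j m : reduced m ->
  sderiv j (scoord i * smon m) = (i == j)%:R *: smon m +
    (-1) ^+ (eps i && eps j) *: (scoord i * sderiv j (smon m)).
Proof.
move=> rm; rewrite scoordM sderivZ (sderiv_smon j rm) -scalerAr scoordM !scalerA.
have [mj0|mj] := posnP (m j).
  rewrite mj0 mulr0n mulr0 mul0r scale0r addr0.
  have [r|/[dup] nr /smonN->] := boolP (reduced (U_(i) + m)%MM).
    rewrite sderiv_smon // scalerA mnmDE mj0 addn0 mnm1E.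
    have [->|_] := eqVneq i j; last by rewrite mulr0n mulr0 !scale0r.
    by rewrite mulr1n addmKl ks_addr ks_UU ltnn add0n -exprD signr_dbl.
  rewrite sderiv0 scaler0; have [ij|_] := eqVneq i j; last by rewrite scale0r.
  exfalso; apply/negP: nr; rewrite negbK ij; apply/forallP => k; rewrite mnmDE mnm1E.
  by case: eqVneq => [<-|_]; [rewrite mj0 implybT|apply: (forallP rm)].
have E := mnm_pred mj; set m' := (m - U_(j))%MM in E *.
have [r|nr] := boolP (reduced (U_(i) + m)%MM).
  rewrite sderiv_smon // scalerA.
  have [ij|ij] := eqVneq i j.
    have ei : eps i = false.
      have /forallP/(_ i) := r; rewrite mnmDE mnm1E eqxx ij; case: (eps j) => //=.
      by move: mj; case: (m j).
    rewrite -ij addmKl /m' -ij ei !ks_even //= !expr0 !mul1r mulr1.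
    rewrite -mnm_pred ?ij // -scalerDl mnmDE mnm1E eqxx.
    by congr (_ *: _); rewrite -[1 in RHS](mulr1n (1:R)) -mulrnDr.
  rewrite scale0r add0r mnmDE mnm1E (negPf ij) add0n.
  have -> : (U_(i) + m - U_(j))%MM = (U_(i) + m')%MM.
    by rewrite {1}E addmA [(U_(i) + _)%MM]addmC -addmA addmKl.
  have -> : ks U_(i) m = (ks U_(i) U_(j) + ks U_(i) m')%N by rewrite {1}E ks_addr.
  congr (_ *: _); rewrite !mulrnAr ?mulrnAl ?mulrnAr; congr (_ *+ _).
  rewrite -!exprD -[LHS]signr_odd -[RHS]signr_odd; congr (_ ^+ nat_of_bool _).
  rewrite !oddD !ks_addr !oddD !ks_UU !oddb.
  move: ij; rewrite -(inj_eq val_inj) neq_ltn.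
  move: (odd (ks U_(i) m')) (odd (ks U_(j) m)) => x y.
  by case: ltngtP => //= _ _; case: (eps i) (eps j) x y => [] [] [] [].
rewrite (smonN nr) sderiv0 scaler0.
have [ij|ij] := eqVneq i j.
  have ei : eps i.
    apply: contraR nr => ei; apply/forallP => k; rewrite mnmDE mnm1E.
    by case: eqVneq => [<-|_]; [rewrite (negPf ei)|apply: (forallP rm)].
  have mj1 : m j = 1%N.
    by have /forallP/(_ j) := rm; rewrite -ij ei /= ij; move: mj; case: (m j) => [|[]].
  rewrite ij -E mj1 mulr1n -ij ei /= ij {2}E ks_addr ks_UU ltnn add0n.
  by rewrite -mulrA -exprD signr_dbl mulr1 scale1r scaleN1r subrr.
rewrite scale0r add0r smonN ?scaler0 //; apply: contra nr => r.
apply/forallP => k; have := forallP r k; rewrite /m' !mnmDE mnmBE !mnm1E.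
case: (eqVneq j k) => [<-|_]; last by rewrite subn0.
by have := forallP rm j; rewrite (negPf ij).
Qed.

Lemma sderiv_coordM i j f :
  sderiv j (scoord i * f) = (i == j)%:R *: f +
    (-1) ^+ (eps i && eps j) *: (scoord i * sderiv j f).
Proof.
elim/spoly_ind: f => [|c m f rm IH].
  by rewrite mulr0 sderiv0 mulr0 !scaler0 addr0.
rewrite mulrDr -scalerAr !sderivP IH mulrDr -scalerAr !scalerDr.
rewrite sderiv_coordM_smon // scalerDr !scalerA [_ * c]mulrC [_ * c in RHS]mulrC.
by rewrite addrACA.
Qed.

Lemma smonU i m :
  smon (U_(i) + m)%MM = (-1) ^+ ks U_(i) m *: (scoord i * smon m).
Proof. by rewrite scoordM scalerA -exprD signr_dbl scale1r. Qed.

Lemma sderiv1 j : sderiv j 1 = 0.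
Proof. by rewrite -smon0 sderiv_smon ?reduced0 // mnm0E mulr0n scale0r. Qed.

Lemma leibniz_step (A : algType R) (s t u v d : R) (y a D f F : A) : v = t * u ->
  s *: (d *: (a * f) + t *: (y * (D * f + u *: (a * F)))) =
  s *: ((d *: a + t *: (y * D)) * f) + v *: (s *: (y * a * F)).
Proof.
move=> ->; rewrite [_ *: (s *: _)]scalerA [_ * s]mulrC -[_ *: (y * a * F)]scalerA.
rewrite -scalerDr; congr (_ *: _).
rewrite mulrDl mulrDr -!scalerAl scalerDr -scalerAr scalerA !mulrA.
by rewrite addrA.
Qed.

Lemma sderivM j e f f' : has_parity e f ->
  sderiv j (f * f') =
  sderiv j f * f' + (-1) ^+ (e && eps j) *: (f * sderiv j f').
Proof.
move=> hf; elim/supp_in_ind: f / hf => [|c m f _ /eqP Pm IH].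
  by rewrite sderiv0 !mul0r sderiv0 scaler0 addr0.
rewrite !mulrDl -!scalerAl !sderivP IH mulrDl scalerDr -scalerAl.
suff -> : sderiv j (smon m * f') = sderiv j (smon m) * f' +
  (-1) ^+ (e && eps j) *: (smon m * sderiv j f').
  by rewrite scalerDr !scalerA [_ * c]mulrC addrACA.
rewrite -{e IH}Pm; elim/smon_coord_ind: m => [|i m IH].
  by rewrite smon0 sderiv1 mul0r !mul1r add0r monpar0 scale1r.
rewrite smonU -!scalerAl !sderivZ -!scalerAl -mulrA !sderiv_coordM IH.
apply: leibniz_step; rewrite monparD monparU oddD oddb -signr_addb.
congr (_ ^+ nat_of_bool _).
by case: (eps i) (eps j) (odd _) => [] [] [].
Qed.

Lemma has_parity_sderiv j e f : has_parity e f ->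
  has_parity (e (+) eps j) (sderiv j f).
Proof.
apply: supp_in_slin => m rm /eqP <-; have [->|/mnm_pred E] := posnP (m j).
  by rewrite mulr0n scale0r supp_in0.
apply/supp_inZ/supp_in_smon; rewrite {2}E monparD monparU oddD oddb.
by case: (eps j); case: odd.
Qed.

Lemma has_weight_sderiv j (d : int) f : has_weight d f ->
  has_weight (d - (w j)%:Z) (sderiv j f).
Proof.
apply: supp_in_slin => m rm /eqP <-; have [->|/mnm_pred E] := posnP (m j).
  by rewrite mulr0n scale0r supp_in0.
apply/supp_inZ/supp_in_smon; rewrite {2}E monwtD monwtU.
by rewrite PoszD addrAC subrr add0r.
Qed.

Lemma scale_mul_sumr (A : algType R) (s : R) (a : A) (F : 'I_n -> A) :
  s *: (a * \sum_(k < n) F k) = \sum_(k < n) s *: (a * F k).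
Proof. by rewrite mulr_sumr scaler_sumr. Qed.

Lemma chain_rule g j f : smap_even g ->
  sderiv j (pullback g f) =
  \sum_(k < n) sderiv j (g k) * pullback g (sderiv k f).
Proof.
move=> ge; elim/spoly_coord_ind: f => [||c f1 f2 IH1 IH2|i f IH].
- rewrite pullback0 sderiv0 big1 // => k _.
  by rewrite sderiv0 pullback0 mulr0.
- rewrite pullback1 sderiv1 big1 // => k _.
  by rewrite sderiv1 pullback0 mulr0.
- rewrite pullbackP sderivP IH1 IH2 scaler_sumr -big_split; apply: eq_bigr => k _.
  by rewrite sderivP pullbackP mulrDr -scalerAr.
have gi := forallP ge i.
rewrite pullback_coordM // (sderivM _ _ gi) IH.
transitivity (\sum_(k < n) ((i == k)%:R *: (sderiv j (g k) * pullback g f) +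
  (-1) ^+ (eps i && eps j) *: (g i * (sderiv j (g k) * pullback g (sderiv k f))))).
  rewrite big_split /= [X in _ = X + _](bigD1 i) //= eqxx scale1r.
  rewrite [X in _ = _ + X + _]big1 ?addr0; last first.
    by move=> k ki; rewrite eq_sym (negPf ki) scale0r.
  by rewrite scale_mul_sumr.
apply: eq_bigr => k _; rewrite sderiv_coordM pullbackP pullbackZ pullback_coordM //.
rewrite mulrDr -!scalerAr; congr (_ + _).
rewrite !mulrA (supercomm gi (has_parity_sderiv j (forallP ge k))).
rewrite -scalerAl scalerA -signr_addb; congr (_ ^+ nat_of_bool _ *: _).
by case: (eps i); case: (eps j); case: (eps k).
Qed.

(* A transformation of a superspace is an even map, so an inverse preserves
   parity; that the inverse of a weight-preserving transformation preserves
   weights is inverse_weight. *)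
Definition smap_invertible (g : smap) : Prop :=
  exists h, [/\ smap_even h, scomp g h = sid & scomp h g = sid].

Definition is_graded_transf : {pred smap} :=
  fun g => [&& smap_even g, smap_weight g & `[< smap_invertible g >]].

Record ggroup := GG { gg_map :> {ffun 'I_n -> spoly}; _ : is_graded_transf gg_map }.
HB.instance Definition _ := [isSub for gg_map].
HB.instance Definition _ := [Choice of ggroup by <:].

Lemma gg_even (g : ggroup) : smap_even g.
Proof. by case: g => g /= /and3P[]. Qed.
Lemma gg_weight (g : ggroup) : smap_weight g.
Proof. by case: g => g /= /and3P[]. Qed.
Lemma gg_invertible (g : ggroup) : smap_invertible g.
Proof. by case: g => g /= /and3P[_ _ /asboolP]. Qed.

Definition gg_inv_map (g : ggroup) : smap := projT1 (cid (gg_invertible g)).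
Lemma gg_inv_mapP g : [/\ smap_even (gg_inv_map g),
  scomp g (gg_inv_map g) = sid & scomp (gg_inv_map g) g = sid].
Proof. exact: projT2 (cid (gg_invertible g)). Qed.

Fact gg_one_subproof : is_graded_transf sid.
Proof.
apply/and3P; split; [exact: sid_even|exact: sid_weight|].
by apply/asboolP; exists sid; rewrite scomp1r; split=> //; apply: sid_even.
Qed.
Fact gg_inv_subproof g : is_graded_transf (gg_inv_map g).
Proof.
have [he gh hg] := gg_inv_mapP g; apply/and3P; split => //.
  exact: inverse_weight (gg_even g) he (gg_weight g) gh hg.
by apply/asboolP; exists g; split=> //; apply: gg_even.
Qed.
Fact gg_mul_subproof (g h : ggroup) : is_graded_transf (scomp g h).
Proof.
have [ge he] := (gg_even g, gg_even h).
have [g'e gg' g'g] := gg_inv_mapP g; have [h'e hh' h'h] := gg_inv_mapP h.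
apply/and3P; split; [exact: scomp_even|apply: scomp_weight; exact: gg_weight|].
apply/asboolP; exists (scomp (gg_inv_map h) (gg_inv_map g)); split.
- exact: scomp_even.
- by rewrite -scompA ?scomp_even // (scompA h) // hh' scomp1l.
- by rewrite -scompA ?scomp_even // (scompA (gg_inv_map g)) // g'g scomp1l.
Qed.

Definition gg_one : ggroup := GG gg_one_subproof.
Definition gg_inv g : ggroup := GG (gg_inv_subproof g).
Definition gg_mul g h : ggroup := GG (gg_mul_subproof g h).

Fact gg_mulA : associative gg_mul.
Proof. by move=> g h k; apply/val_inj/scompA; apply: gg_even. Qed.
Fact gg_mul1g : left_id gg_one gg_mul.
Proof. by move=> g; apply/val_inj/scomp1l/gg_even. Qed.
Fact gg_mulg1 : right_id gg_one gg_mul.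
Proof. by move=> g; apply/val_inj/scomp1r. Qed.
Fact gg_mulVg : left_inverse gg_one gg_inv gg_mul.
Proof. by move=> g; apply/val_inj; case: (gg_inv_mapP g). Qed.
Fact gg_mulgV : right_inverse gg_one gg_inv gg_mul.
Proof. by move=> g; apply/val_inj; case: (gg_inv_mapP g). Qed.
HB.instance Definition _ :=
  isGroup.Build ggroup gg_mulA gg_mul1g gg_mulg1 gg_mulVg gg_mulgV.

(* X stands for the sum of the X i d/dy^i; even, odd and mixed fields are allowed. *)
Definition vfield := {ffun 'I_n -> spoly}.

Definition vf_apply (X : vfield) (f : spoly) : spoly :=
  \sum_(i < n) X i * sderiv i f.

Definition vf_weight (k : int) (X : vfield) :=
  [forall i, has_weight (k + (w i)%:Z) (X i)].

(* As an operator on functions, pushforward g X is (g^-1)^* X g^*, see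
   pushforward_apply; its coefficients are its values on the coordinates. *)
Definition pushforward (g : ggroup) (X : vfield) : vfield :=
  [ffun i => pullback (g^-1)%g (vf_apply X (g i))].

Lemma vf_applyP c X Y f :
  vf_apply (c *: X + Y) f = c *: vf_apply X f + vf_apply Y f.
Proof.
rewrite /vf_apply scaler_sumr -big_split; apply: eq_bigr => i _.
by rewrite !ffunE mulrDl scalerAl.
Qed.

Lemma vf_apply_weight k d X f : vf_weight k X -> has_weight d f ->
  has_weight (k + d) (vf_apply X f).
Proof.
move=> /forallP hX hf; apply: supp_in_sum => i _.
have -> : k + d = k + (w i)%:Z + (d - (w i)%:Z) by ring.
exact/has_weightM/has_weight_sderiv.
Qed.

Lemma vf_apply_pullback g X f : smap_even g -> vf_apply X (pullback g f) =
  \sum_(k < n) vf_apply X (g k) * pullback g (sderiv k f).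
Proof.
move=> ge; transitivity (\sum_(i < n) \sum_(k < n)
    X i * (sderiv i (g k) * pullback g (sderiv k f))).
  by apply: eq_bigr => i _; rewrite chain_rule // mulr_sumr.
rewrite exchange_big; apply: eq_bigr => k _; rewrite /vf_apply mulr_suml.
by apply: eq_bigr => i _; rewrite mulrA.
Qed.

Lemma gg_mulE (g h : ggroup) : (g * h)%g = scomp g h :> smap.
Proof. by []. Qed.
Lemma gg_invK (g : ggroup) f : pullback (g^-1)%g (pullback g f) = f.
Proof.
rewrite -pullback_comp ?gg_even // -gg_mulE mulgV.
exact: pullback_sid.
Qed.

Lemma pushforward_apply (g : ggroup) X f :
  vf_apply (pushforward g X) f = pullback (g^-1)%g (vf_apply X (pullback g f)).
Proof.
rewrite vf_apply_pullback ?gg_even // pullback_sum; apply: eq_bigr => i _.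
by rewrite pullbackM ?gg_even // gg_invK ffunE.
Qed.

Lemma pushforward_linear g : linear (pushforward g).
Proof.
by move=> c X Y; apply/ffunP => i; rewrite !ffunE vf_applyP pullbackP.
Qed.
HB.instance Definition _ g :=
  GRing.isLinear.Build R vfield vfield _ (pushforward g) (pushforward_linear g).

Lemma vf_apply_coord X i : vf_apply X (scoord i) = X i.
Proof.
rewrite /vf_apply (bigD1 i) //= big1 ?addr0 => [|j ji].
  by rewrite -[scoord i]mulr1 sderiv_coordM eqxx sderiv1 mulr0 scaler0 addr0 scale1r mulr1.
rewrite -[scoord i]mulr1 sderiv_coordM sderiv1 mulr0 scaler0 addr0 eq_sym.
by rewrite (negPf ji) scale0r mulr0.
Qed.

Lemma pushforward1 X : pushforward 1%g X = X.
Proof.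
apply/ffunP => i; rewrite ffunE invg1 pullback_sid.
by rewrite -[RHS]vf_apply_coord [X in vf_apply _ X]ffunE.
Qed.

Lemma pushforwardM (g h : ggroup) X :
  pushforward (g * h)%g X = pushforward g (pushforward h X).
Proof.
apply/ffunP => i; rewrite !ffunE pushforward_apply invgM gg_mulE.
by rewrite pullback_comp ?gg_even // gg_mulE ffunE.
Qed.

Lemma pushforward_weight g k X :
  vf_weight k X -> vf_weight k (pushforward g X).
Proof.
move=> hX; apply/forallP => i; rewrite ffunE.
apply/pullback_weight/vf_apply_weight => //; first exact: gg_weight.
exact: (forallP (gg_weight g)).
Qed.

Definition max_weight : nat := \max_(i < n) w i.

(* Vect_(-N) + ... + Vect_(-1), where N = max_weight and 'I_N is shifted by one. *)
Definition neg_vfield : {pred vfield} := fun X =>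
  `[< exists Y : 'I_max_weight -> vfield,
      (forall k : 'I_max_weight, vf_weight (- k.+1%:Z) (Y k)) /\ X = \sum_k Y k >].

Lemma vf_weightP k c X Y :
  vf_weight k X -> vf_weight k Y -> vf_weight k (c *: X + Y).
Proof.
move=> /forallP hX /forallP hY; apply/forallP => i; rewrite !ffunE.
by apply: supp_inP; [exact: hX|exact: hY].
Qed.
Lemma vf_weight0 k : vf_weight k 0.
Proof. by apply/forallP => i; rewrite ffunE; apply: supp_in0. Qed.

Fact neg_vfield_submod : submod_closed neg_vfield.
Proof.
split.
  apply/asboolP; exists (fun=> 0); split; last by rewrite big1.
  by move=> k; apply: vf_weight0.
move=> c X X' /asboolP[Y [hY ->]] /asboolP[Y' [hY' ->]].
apply/asboolP; exists (fun k => c *: Y k + Y' k); split.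
  by move=> k; apply: vf_weightP.
by rewrite scaler_sumr -big_split.
Qed.
HB.instance Definition _ := GRing.isSubmodClosed.Build R vfield neg_vfield
  neg_vfield_submod.

Record vect_neg := VectNeg { vn_field :> {ffun 'I_n -> spoly}; _ : neg_vfield vn_field }.
HB.instance Definition _ := [isSub for vn_field].
HB.instance Definition _ := [Choice of vect_neg by <:].
HB.instance Definition _ := [SubChoice_isSubLmodule of vect_neg by <:].

Fact gg_act_subproof (g : ggroup) (X : vect_neg) : neg_vfield (pushforward g X).
Proof.
case: X => X /= /asboolP[Y [hY ->]]; apply/asboolP.
exists (fun k => pushforward g (Y k)); split.
  by move=> k; apply: pushforward_weight.
by rewrite (raddf_sum (pushforward g)).
Qed.
Definition gg_act (g : ggroup) (X : vect_neg) : vect_neg :=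
  VectNeg (gg_act_subproof g X).

Fact gg_act_linear g : linear (gg_act g).
Proof. by move=> c X Y; apply/val_inj/pushforward_linear. Qed.
Fact gg_act1 X : gg_act 1%g X = X.
Proof. exact/val_inj/pushforward1. Qed.
Fact gg_actM g h X : gg_act (g * h)%g X = gg_act g (gg_act h X).
Proof. exact/val_inj/pushforwardM. Qed.

End SuperPolynomials.

Record representation (R : nzRingType) (G : groupType) (M : lmodType R) :=
  Representation {
    rep_act :> G -> M -> M;
    rep_linear : forall g, linear (rep_act g);
    rep1 : forall v, rep_act 1%g v = v;
    repM : forall g h v, rep_act (g * h)%g v = rep_act g (rep_act h v) }.

Definition faithful R G M (rho : @representation R G M) :=
  forall g h, rho g =1 rho h -> g = h.

Definition gg_rep (R : realFieldType) (V : gspace) :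
    representation (ggroup R V) (vect_neg R V) :=
  Representation (@gg_act_linear R V) (@gg_act1 R V) (@gg_actM R V).

(* Main.v *)
(** The coordinate fields [d/dy^j] have negative weight, so a transformation [g]
    acting trivially on [Vect^-] satisfies [dg^i/dy^j = delta_ij]: the component
    [g^i - y^i] has vanishing derivatives. It is homogeneous of weight
    [w(y^i) > 0], hence zero by Euler's identity. *)
Require Import Defs.
From mathcomp Require Import all_boot all_order all_algebra.
From mathcomp Require Import boolp mpoly reals.

Set Implicit Arguments.
Unset Strict Implicit.
Unset Printing Implicit Defensive.

Import GRing.Theory Num.Theory.
Local Open Scope ring_scope.

Section Faithfulness.
Context (R : realFieldType) (V : gspace).
Local Notation n := (gdim V).
Local Notation w := (@weight V).
Implicit Types (f : spoly R V) (g : ggroup R V).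

(** Taking [y^j] out of a monomial and multiplying it back in front cross the same odd factors, so
    the two signs cancel. *)
Lemma scoordM_sderiv j (m : 'X_{1..n}) : reduced m ->
  scoord R j * sderiv j (smon R m) = (m j)%:R *: smon R m.
Proof.
move=> rm; rewrite sderiv_smon // -scalerAr scoordM scalerA.
have [->|/mnm_pred E] := posnP (m j); first by rewrite mulr0n mul0r !scale0r.
by rewrite -E {1}E ks_addr ks_UU ltnn add0n mulrnAl -exprD signr_dbl.
Qed.

(** Each [y^j d/dy^j] multiplies a monomial [m] by [m j]; summed with the weights [w j], these
    eigenvalues give [monwt m], which is [d]. *)
Lemma euler_weight (d : nat) f : has_weight d f ->
  \sum_(j < n) (w j)%:R *: (scoord R j * sderiv j f) = d%:R *: f.
Proof.
move=> hf; elim/supp_in_ind: f / hf => [|c m f rm /eqP[<-] IH].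
  by rewrite scaler0 big1 // => j _; rewrite sderiv0 mulr0 scaler0.
under eq_bigr do rewrite sderivP mulrDr scalerDr -scalerAr scoordM_sderiv //.
rewrite big_split /= IH scalerDr; congr (_ + _).
under eq_bigr do rewrite scalerA mulrC -scalerA [_%:R *: (_%:R *: _)]scalerA -natrM mulnC.
by rewrite -scaler_sumr -scaler_suml -natr_sum scalerA [RHS]scalerA mulrC.
Qed.

(** Euler's identity becomes [d *: f = 0], and a positive integer is nonzero in an ordered field. *)
Lemma sderiv_eq0 (d : nat) f : (0 < d)%N -> has_weight d f ->
  (forall j, sderiv j f = 0) -> f = 0.
Proof.
move=> d0 /euler_weight + df; rewrite big1 => [/esym/eqP|j _].
  by rewrite scaler_eq0 pnatr_eq0 eqn0Ngt d0 => /eqP.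
by rewrite df mulr0 scaler0.
Qed.

Definition coord_field (j : 'I_n) : vfield R V := [ffun i => (i == j)%:R].

Lemma coord_fieldE j f : vf_apply (coord_field j) f = sderiv j f.
Proof.
rewrite /vf_apply (bigD1 j) //= ffunE eqxx mul1r big1 ?addr0 // => i ij.
by rewrite ffunE (negPf ij) mul0r.
Qed.

Lemma vf_weight_coord_field j : vf_weight (- (w j)%:Z) (coord_field j).
Proof.
apply/forallP => i; rewrite ffunE; case: eqP => [->|_].
  by rewrite addNr has_weight1.
exact: supp_in0.
Qed.

Lemma neg_coord_field j : neg_vfield (coord_field j).
Proof.
have wj : ((w j).-1 < max_weight V)%N.
  by rewrite prednK ?weight_gt0 // /max_weight leq_bigmax.
(* Index [k] carries weight [-(k+1)], so [d/dy^j] sits alone at index [w j - 1]. *)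
apply/asboolP; exists (fun k => if k == Ordinal wj then coord_field j else 0).
split=> [k|]; last by rewrite -big_mkcond big_pred1_eq.
case: eqP => [->|_]; last exact: vf_weight0.
by rewrite /= prednK ?weight_gt0 //; apply: vf_weight_coord_field.
Qed.

Lemma sderiv_fixed g j : pushforward g (coord_field j) = coord_field j ->
  forall i, sderiv j (g i) = (i == j)%:R.
Proof.
move=> gj i; have /ffunP/(_ i) := gj; rewrite !ffunE coord_fieldE => gE.
(* By [gE], the derivative pulled back along the inverse of [g] is a constant; pulling back along
   [g] restores the derivative and fixes the constant. *)
rewrite -[LHS](gg_invK g^-1%g) invgK gE.
by case: eqP => _; rewrite ?pullback1 ?pullback0.
Qed.

Lemma fix_coord_fields g :
  (forall j, pushforward g (coord_field j) = coord_field j) -> g = 1%g.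
Proof.
move=> gfix; apply/val_inj/ffunP => i; rewrite [RHS]ffunE.
apply/eqP; rewrite -subr_eq0; apply/eqP.
(* Equal derivatives still allow a constant difference; the positive weight of [y^i] excludes it. *)
apply: (sderiv_eq0 (weight_gt0 i)) => [|j].
  rewrite addrC -scaleN1r; apply: supp_inP; first exact: has_weight_scoord.
  exact: (forallP (gg_weight g)).
rewrite addrC -scaleN1r sderivP sderiv_fixed // -[scoord _ i]mulr1 sderiv_coordM.
rewrite sderiv1 mulr0 scaler0 addr0.
by case: eqP => _; rewrite ?scale1r ?scale0r ?scaler0 ?addr0 // scaleN1r addNr.
Qed.

Lemma gg_rep_faithful : faithful (gg_rep R V).
Proof.
(* Injectivity reduces to a trivial kernel: [h^-1 * g] acts trivially. *)
move=> g h gh; suff /(congr1 (fun k => h * k)%g): (h^-1 * g = 1)%g.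
  by rewrite mulgA mulgV mul1g mulg1.
apply: fix_coord_fields => j; pose X := VectNeg (neg_coord_field j).
have /(congr1 (@vn_field R V)) // : gg_act (h^-1 * g)%g X = X.
by rewrite gg_actM [gg_act g X]gh -[gg_rep R V h X]/(gg_act h X) -gg_actM mulVg gg_act1.
Qed.

End Faithfulness.

Theorem theorem1 (R : realType) (V : gspace) : faithful (gg_rep R V).
Proof. exact: gg_rep_faithful. Qed.
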